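(* The vector space $\mathcal{MD}^{adm}$ is a subalgebra of $\mathcal{MD}$, i.e. it is closed under multiplication of power series.
   Context: For integers $r_1,\dots,r_l\ge 0$ and $n\ge 1$ let $\sigma_{r_1,\dots,r_l}(n)=\sum v_1^{r_1}\cdots v_l^{r_l}$, summed over positive integers $u_1>\dots>u_l>0$, $v_1,\dots,v_l>0$ with $u_1v_1+\dots+u_lv_l=n$. For integers $s_1,\dots,s_l\ge1$ the bracket is $[s_1,\dots,s_l]=\frac{1}{(s_1-1)!\cdots(s_l-1)!}\sum_{n>0}\sigma_{s_1-1,\dots,s_l-1}(n)q^n\in\mathbb{Q}[[q]]$. $\mathcal{MD}$ is the $\mathbb{Q}$-span of $1$ and all brackets; it is a $\mathbb{Q}$-algebra under multiplication of power series. A bracket $[s_1,\dots,s_l]$ is admissible if $s_1>1$, and $\mathcal{MD}^{adm}$ is the $\mathbb{Q}$-span of $1$ and all admissible brackets. *)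

(* Defs.v *)
From HB Require Import structures.
From mathcomp Require Import all_boot all_order all_algebra.
From mathcomp Require Import boolp classical_sets.

Set Implicit Arguments.
Unset Strict Implicit.
Unset Printing Implicit Defensive.

Import GRing.Theory.
Local Open Scope ring_scope.

(* The formal power series ring R[[q]]; [Fps f] is \sum_n f n * q^n. A record
   rather than an alias of [nat -> R], on which the multiplication inferred by
   MathComp-Analysis is the pointwise one. *)
Record fps (R : Type) := Fps { coefs : nat -> R }.

Section FpsAlgebra.
Variable R : comNzRingType.
Implicit Types f g h : fps R.

HB.instance Definition _ := gen_eqMixin (fps R).
HB.instance Definition _ := gen_choiceMixin (fps R).

Lemma fpsP f g : (forall n, coefs f n = coefs g n) -> f = g.
Proof. by case: f g => [f] [g] /funext /= ->. Qed.

Definition fps_zero : fps R := Fps (fun=> 0).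
Definition fps_opp f := Fps (fun n => - coefs f n).
Definition fps_add f g := Fps (fun n => coefs f n + coefs g n).

Fact fps_addA : associative fps_add.
Proof. by move=> f g h; apply: fpsP => n; exact: addrA. Qed.
Fact fps_addC : commutative fps_add.
Proof. by move=> f g; apply: fpsP => n; exact: addrC. Qed.
Fact fps_add0 : left_id fps_zero fps_add.
Proof. by move=> f; apply: fpsP => n; exact: add0r. Qed.
Fact fps_addN : left_inverse fps_zero fps_opp fps_add.
Proof. by move=> f; apply: fpsP => n; exact: addNr. Qed.

HB.instance Definition _ :=
  GRing.isZmodule.Build (fps R) fps_addA fps_addC fps_add0 fps_addN.

Definition fps_one : fps R := Fps (fun n => (n == 0%N)%:R).
Definition fps_mul f g :=
  Fps (fun n => \sum_(i < n.+1) coefs f i * coefs g (n - i)%N).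

(* The ring axioms are transported from {poly R} by truncation. *)
Definition fps_trunc m f : {poly R} := \poly_(i < m) coefs f i.

Lemma coef_trunc m f n : (n < m)%N -> (fps_trunc m f)`_n = coefs f n.
Proof. by move=> nm; rewrite coef_poly nm. Qed.

Lemma coef_trunc_mul m f g n : (n < m)%N ->
  (fps_trunc m f * fps_trunc m g)`_n = coefs (fps_mul f g) n.
Proof.
move=> nm; rewrite coefM; apply: eq_bigr => i _.
by rewrite !coef_trunc// (leq_ltn_trans _ nm)// ?leq_subr// -ltnS.
Qed.

Fact fps_mulC : commutative fps_mul.
Proof.
by move=> f g; apply: fpsP => n; rewrite -!(coef_trunc_mul _ _ (ltnSn n)) mulrC.
Qed.
Fact fps_mulA : associative fps_mul.
Proof.
move=> f g h; apply: fpsP => n.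
have truncM p1 p2 p3 : coefs (fps_mul p1 (fps_mul p2 p3)) n =
    (fps_trunc n.+1 p1 * (fps_trunc n.+1 p2 * fps_trunc n.+1 p3))`_n.
  rewrite coefM; apply: eq_bigr => i _.
  by rewrite coef_trunc// coef_trunc_mul// ltnS leq_subr.
by rewrite [fps_mul (fps_mul f g) h]fps_mulC !truncM mulrA mulrC.
Qed.
Fact fps_mul1 : left_id fps_one fps_mul.
Proof.
move=> f; apply: fpsP => n; rewrite /= big_ord_recl /= mul1r subn0.
by rewrite big1 ?addr0// => i _; rewrite mul0r.
Qed.
Fact fps_mulDl : left_distributive fps_mul fps_add.
Proof.
move=> f g h; apply: fpsP => n; rewrite /= -big_split /=.
by apply: eq_bigr => i _; rewrite mulrDl.
Qed.
Fact fps_one_neq0 : fps_one != 0.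
Proof.
apply/eqP => /(congr1 (fun f => coefs f 0%N)) /= /eqP.
by rewrite oner_eq0.
Qed.

HB.instance Definition _ := GRing.Zmodule_isComNzRing.Build (fps R)
  fps_mulA fps_mulC fps_mul1 fps_mulDl fps_one_neq0.

Definition fps_scale (a : R) f := Fps (fun n => a * coefs f n).

Fact fps_scaleA a b f : fps_scale a (fps_scale b f) = fps_scale (a * b) f.
Proof. by apply: fpsP => n; exact: mulrA. Qed.
Fact fps_scale1 : left_id 1 fps_scale.
Proof. by move=> f; apply: fpsP => n; exact: mul1r. Qed.
Fact fps_scaleDr : right_distributive fps_scale +%R.
Proof. by move=> a f g; apply: fpsP => n; exact: mulrDr. Qed.
Fact fps_scaleDl f : {morph fps_scale^~ f : a b / a + b}.
Proof. by move=> a b; apply: fpsP => n; exact: mulrDl. Qed.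

HB.instance Definition _ := GRing.Zmodule_isLmodule.Build R (fps R)
  fps_scaleA fps_scale1 fps_scaleDr fps_scaleDl.

Fact fps_scaleAl (a : R) f g : a *: (f * g) = a *: f * g.
Proof.
apply: fpsP => n; rewrite /= big_distrr /=.
by apply: eq_bigr => i _; rewrite mulrA.
Qed.

HB.instance Definition _ := GRing.Lmodule_isLalgebra.Build R (fps R) fps_scaleAl.
HB.instance Definition _ := GRing.Lalgebra_isComAlgebra.Build R (fps R).

End FpsAlgebra.

Definition lin_span (R : nzRingType) (V : lmodType R) (A : set V) : set V :=
  [set v | exists (m : nat) (c : 'I_m -> R) (w : 'I_m -> V),
     (forall i, A (w i)) /\ v = \sum_(i < m) c i *: w i].

(* sigma_{r_1,...,r_l}(n), with l = size r and indices shifted to start at 0.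
   The variables u_i, v_i range over {0,...,n}: being positive with
   \sum u_i v_i = n, they are automatically at most n. *)
Definition sigma (r : seq nat) (n : nat) : nat :=
  (\sum_(uv : {ffun 'I_(size r) -> 'I_n.+1} * {ffun 'I_(size r) -> 'I_n.+1}
       | [&& [forall i, 0 < uv.1 i], [forall i, 0 < uv.2 i],
             [forall i : 'I_(size r), forall j : 'I_(size r),
                (i < j) ==> (uv.1 j < uv.1 i)]
           & \sum_i uv.1 i * uv.2 i == n])
     \prod_(i < size r) uv.2 i ^ nth 0 r i)%N.

Definition bracket (s : seq nat) : fps rat :=
  (\prod_(k <- s) (k.-1)`!)%:R^-1 *:
    Fps (fun n => if (0 < n)%N then (sigma (map predn s) n)%:R else 0).

(* The indices s_1, ..., s_l >= 1 of a bracket, with l >= 1. *)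
Definition bracket_index (s : seq nat) : bool :=
  (0 < size s)%N && all (leq 1) s.

Definition admissible (s : seq nat) : bool :=
  bracket_index s && (1 < head 0 s)%N.

Definition MD : set (fps rat) :=
  lin_span [set f | f = 1 \/ exists2 s, bracket_index s & f = bracket s].

Definition MDadm : set (fps rat) :=
  lin_span [set f | f = 1 \/ exists2 s, admissible s & f = bracket s].

(* Main.v *)
(** A bracket is, up to a nonzero scalar, the sum over u_1 > ... > u_l > 0 of
    products of series \sum_(v > 0) p_i(v) q^(u_i v) with p_i = X^(s_i - 1), and
    admissibility says that p_1(0) = 0. Words of arbitrary polynomials p_i
    multiply by a quasi-shuffle rule in which two letters p, q merge into the
    polynomial r with r(n) = \sum_(0 < v < n) p(v) q(n - v). The first letter of
    a word in a product of two words is the first letter of one factor, or the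
    merger of the two. The polynomial \sum_(0 <= v < n) p(v) q(n - v) vanishes at
    n = 0, so r(0) = - p(0) q(0), and the words of the product still satisfy
    p_1(0) = 0. *)
Require Import Defs.
From mathcomp Require Import all_boot all_order all_algebra.
From mathcomp Require Import boolp classical_sets.
From mathcomp Require Import ring.

Set Implicit Arguments.
Unset Strict Implicit.
Unset Printing Implicit Defensive.

Import GRing.Theory.
Local Open Scope ring_scope.

(** * Power series up to a given degree *)

Section FpsCoefs.
Variable R : comNzRingType.
Implicit Types f g : fps R.

Lemma coefsD f g n : coefs (f + g) n = coefs f n + coefs g n.
Proof. by []. Qed.

Lemma coefsZ (a : R) f n : coefs (a *: f) n = a * coefs f n.
Proof. by []. Qed.

Lemma coefsM f g n :
  coefs (f * g) n = \sum_(i < n.+1) coefs f i * coefs g (n - i)%N.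
Proof. by []. Qed.

Lemma coefs_sum I (r : seq I) (P : pred I) (E : I -> fps R) n :
  coefs (\sum_(i <- r | P i) E i) n = \sum_(i <- r | P i) coefs (E i) n.
Proof. by elim/big_rec2: _ => // i _ y _ <-. Qed.

(** Congruence modulo q^(n+1), under which the infinite sums over v can be cut to finite ones. *)
Definition eq_upto n f g := forall m, (m <= n)%N -> coefs f m = coefs g m.

Lemma eq_uptoM n f1 f2 g1 g2 : eq_upto n f1 f2 -> eq_upto n g1 g2 ->
  eq_upto n (f1 * g1) (f2 * g2).
Proof.
move=> ef eg m mn; rewrite !coefsM; apply: eq_bigr => i _.
rewrite ef ?eg //; first by rewrite (leq_trans (leq_subr _ _)).
by rewrite (leq_trans _ mn) // -ltnS.
Qed.

Lemma eq_upto_prod n I (r : seq I) (E1 E2 : I -> fps R) :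
  (forall i, eq_upto n (E1 i) (E2 i)) ->
  eq_upto n (\prod_(i <- r) E1 i) (\prod_(i <- r) E2 i).
Proof. by move=> eE; elim/big_rec2: _ => // i f g _; apply: eq_uptoM. Qed.

Definition fps_monom (a : nat) : fps R := Fps (fun n => (n == a)%:R).

Lemma fps_monomD a b : fps_monom (a + b) = fps_monom a * fps_monom b.
Proof.
apply: fpsP => n; rewrite coefsM /=; have [an|na] := ltnP a n.+1; last first.
  rewrite big1 => [|i _]; first by case: eqP => // e; rewrite e ltnNge leq_addr in na.
  by rewrite (ltn_eqF (leq_trans (ltn_ord i) na)) mul0r.
rewrite (bigD1 (Ordinal an)) //= eqxx mul1r big1 ?addr0.
  by rewrite -(eqn_add2l a (n - a)) subnKC.
move=> i; rewrite -val_eqE /= => /negbTE ->; exact: mul0r.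
Qed.

End FpsCoefs.

(** * Polynomiality of convolution sums *)

Section Convolution.
Variable F : numFieldType.
Implicit Types p q : {poly F}.

(* Expanding in binomial coefficients makes summation a mere index shift:
   X C(X, k) = (k+1) C(X, k+1) + k C(X, k) and
   \sum_(v < n) C(v, k) = C(n, k+1). *)
Lemma binomial_sum_poly p k : exists s : {poly F},
  forall n, s.[n%:R] = \sum_(v < n) p.[v%:R] * 'C(v, k)%:R.
Proof.
have binP j : exists b : {poly F}, forall n, b.[n%:R] = 'C(n, j)%:R.
  elim: j => [|j [b bE]]; first by exists 1 => n; rewrite hornerC bin0.
  (* From (j+1) C(n, j+1) = (n - j) C(n, j); for n < j the truncated difference is harmless, since
     C(n, j) = 0. *)
  exists (j.+1%:R^-1 *: (('X - j%:R%:P) * b)) => n.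
  have j0 : j.+1%:R != 0 :> F by rewrite Num.Theory.pnatr_eq0.
  apply: (mulfI j0); rewrite hornerZ mulrA divff // mul1r !hornerE bE.
  rewrite -natrM mul_bin_left natrM; have [jn|nj] := leqP j n.
    by rewrite natrB.
  by rewrite bin_small // !mulr0.
elim/poly_ind: p k => [|p c IH] k.
  by exists 0 => n; rewrite horner0 big1 // => v _; rewrite horner0 mul0r.
have [s1 s1E] := IH k.+1; have [s2 s2E] := IH k; have [b bE] := binP k.+1.
exists (k.+1%:R *: s1 + k%:R *: s2 + c *: b) => n.
rewrite !hornerE s1E s2E bE !mulr_sumr /=.
have -> : 'C(n, k.+1)%:R = \sum_(v < n) 'C(v, k)%:R :> F.
  elim: n => [|n IHn]; first by rewrite big_ord0.
  by rewrite big_ord_recr /= -IHn binS natrD.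
rewrite mulr_sumr /= -!big_split /=; apply: eq_bigr => v _.
rewrite hornerMXaddC mulrDl.
have -> : p.[v%:R] * v%:R * 'C(v, k)%:R = p.[v%:R] *
    (k.+1%:R * 'C(v, k.+1)%:R + k%:R * 'C(v, k)%:R) :> F.
  rewrite -mulrA -!natrM -natrD mul_bin_left -mulnDl.
  have [kv|vk] := leqP k v; first by rewrite subnK.
  by rewrite bin_small // !muln0.
ring.
Qed.

(** Induction on q: of the factor n - v, the n leaves the sum and the v is absorbed into p, whence
    the induction hypothesis at [p] and at [p * 'X]. *)
Lemma convolution_poly p q : exists c : {poly F},
  forall n, c.[n%:R] = \sum_(v < n) p.[v%:R] * q.[(n - v)%:R].
Proof.
elim/poly_ind: q p => [|q a IH] p.
  by exists 0 => n; rewrite horner0 big1 // => v _; rewrite horner0 mulr0.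
have [c1 c1E] := IH p; have [c2 c2E] := IH (p * 'X).
have [s sE] := binomial_sum_poly p 0.
exists ('X * c1 - c2 + a *: s) => n.
rewrite !hornerE c1E c2E sE !mulr_sumr -sumrN /= -!big_split /=.
apply: eq_bigr => v _; rewrite hornerMX hornerMXaddC bin0 natrB; first by ring.
exact: ltnW.
Qed.

(* The value at 0 is the point: a sum over an empty range has no constant
   term, so that no Bernoulli number need be computed. *)
Lemma inner_convolution_poly p q : exists2 c : {poly F},
  forall n, (0 < n)%N ->
    c.[n%:R] = \sum_(v < n | (0 < v)%N) p.[v%:R] * q.[(n - v)%:R] &
  c.[0] = - (p.[0] * q.[0]).
Proof.
have [c cE] := convolution_poly p q.
(* Subtracting p(0) q(n) removes the term v = 0. *)
exists (c - p.[0] *: q) => [[//|n] _|].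
  rewrite hornerD hornerN hornerZ cE big_ord_recl /= subn0 mulr0n addrAC subrr add0r.
  by rewrite [RHS]big_mkcond big_ord_recl /= add0r.
by rewrite hornerD hornerN hornerZ (cE 0%N) big_ord0 add0r.
Qed.

End Convolution.

(** * Letter and word series and their quasi-shuffle product *)

(* \sum_(v > 0) p(v) q^(u v) *)
Definition letter_series (p : {poly rat}) (u : nat) : fps rat :=
  Fps (fun n => if (0 < n)%N && (u %| n)%N then p.[(n %/ u)%:R] else 0).

(** Both factors live on positive multiples of u, and the coefficient at m u is the inner
    convolution at m, so one r serves every u. *)
Lemma letter_seriesM p q : exists2 r : {poly rat},
  (q.[0] = 0 -> r.[0] = 0) &
  forall u, (0 < u)%N ->
    letter_series p u * letter_series q u = letter_series r u.
Proof.
have [r rE r0] := inner_convolution_poly p q.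
exists r => [q0|u u0]; first by rewrite r0 q0 mulr0 oppr0.
apply: fpsP => n; rewrite coefsM /=.
have [/dvdnP[m ->]|nu] := boolP (u %| n)%N; last first.
  rewrite andbF big1 // => i _; case: ifP => [/andP[_ ui]|]; last by rewrite mul0r.
  case: ifP => [/andP[_ uni]|]; last by rewrite mulr0.
  by rewrite -(subnKC (ltn_ord i : (i <= n)%N)) dvdn_add in nu.
rewrite andbT mulnK // muln_gt0 u0 andbT.
have [->|m0] := posnP m.
  by rewrite /= big_ord_recl big_ord0 /= mul0r add0r.
rewrite rE //.
transitivity (\sum_(i < (m * u).+1 | (u %| i)%N && (0 < i < m * u)%N)
   p.[(i %/ u)%:R] * q.[(m - i %/ u)%:R]).
  rewrite [RHS]big_mkcond; apply: eq_bigr => i _.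
  rewrite subn_gt0 andbC; case: (boolP (u %| i)%N) => [ui|]; last by rewrite /= mul0r.
  rewrite (dvdn_subr (ltn_ord i : (i <= m * u)%N)) ?dvdn_mull // ui andbT.
  rewrite divnBr // mulnK //.
  by case: (0 < i)%N; case: (i < m * u)%N; rewrite /= ?mul0r ?mulr0.
(* The substitution i = v u; since i < m u, reducing i / u modulo m changes nothing and only lands
   it in ['I_m]. *)
rewrite (reindex_onto (fun v : 'I_m => inord (v * u) : 'I_(m * u).+1)
   (fun i => Ordinal (ltn_pmod (i %/ u) m0))) /=; last first.
  move=> i /andP[ui /andP[i0 im]]; apply: val_inj => /=.
  by rewrite modn_small ?ltn_divLR // divnK // inordK.
have vK (v : 'I_m) : (v * u < (m * u).+1)%N.
  by rewrite ltnS leq_mul // ltnW.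
apply: eq_big => [v|v _]; rewrite (inordK (vK v)); last by rewrite mulnK.
rewrite dvdn_mull // muln_gt0 u0 andbT ltn_pmul2r // ltn_ord andbT /=.
by rewrite -val_eqE /= mulnK // modn_small // eqxx andbT.
Qed.

(* For a word p_1, ..., p_l: the sum of \prod_i p_i(v_i) q^(u_i v_i) over
   N >= u_1 > ... > u_l > 0 and v_i > 0. *)
Fixpoint word_series (w : seq {poly rat}) (N : nat) : fps rat :=
  if w is p :: w' then
    \sum_(k < N) letter_series p k.+1 * word_series w' k
  else 1.

Arguments word_series : simpl never.

Lemma word_series_cons p w N : word_series (p :: w) N =
  \sum_(k < N) letter_series p k.+1 * word_series w k.
Proof. by []. Qed.

Lemma word_series_cons0 p w : word_series (p :: w) 0 = 0.
Proof. exact: big_ord0. Qed.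

Lemma word_series_consS p w N : word_series (p :: w) N.+1 =
  word_series (p :: w) N + letter_series p N.+1 * word_series w N.
Proof. exact: big_ord_recr. Qed.

(** One list [xs] must serve every bound N, so that the identity survives both the recursion on N
    and the limit. *)
Definition expands_product (xs : seq (seq {poly rat})) w1 w2 := forall N,
  word_series w1 N * word_series w2 N = \sum_(x <- xs) word_series x N.

(* Compare the three relative positions of the largest summation indices of
   the two factors. *)
Lemma quasi_shuffle_step p q : exists2 r : {poly rat},
  (q.[0] = 0 -> r.[0] = 0) &
  forall w1 w2 xs ys zs,
    expands_product xs w1 (q :: w2) -> expands_product ys (p :: w1) w2 ->
    expands_product zs w1 w2 ->
    expands_product ([seq p :: x | x <- xs] ++ [seq q :: y | y <- ys] ++
                     [seq r :: z | z <- zs]) (p :: w1) (q :: w2).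
Proof.
have [r r0 rE] := letter_seriesM p q.
exists r => // w1 w2 xs ys zs xsE ysE zsE.
have consE s t M : \sum_(x <- [seq s :: x | x <- t]) word_series x M.+1 =
    \sum_(x <- [seq s :: x | x <- t]) word_series x M +
    letter_series s M.+1 * \sum_(x <- t) word_series x M.
  rewrite !big_map mulr_sumr -big_split /=; apply: eq_bigr => x _.
  exact: word_series_consS.
elim=> [|N IHN].
  rewrite word_series_cons0 mul0r !big_cat !big_map /=.
  by rewrite !big1 ?addr0 // => x _; rewrite word_series_cons0.
move: IHN; rewrite !big_cat /= !consE -xsE -ysE -zsE => IHN.
rewrite !word_series_consS -rE //.
transitivity (word_series (p :: w1) N * word_series (q :: w2) N +
  (letter_series p N.+1 * (word_series w1 N * word_series (q :: w2) N) +
   letter_series q N.+1 * (word_series (p :: w1) N * word_series w2 N) +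
   letter_series p N.+1 * letter_series q N.+1 *
     (word_series w1 N * word_series w2 N))); first by ring.
by rewrite IHN /=; ring.
Qed.

Lemma quasi_shuffle w1 w2 : exists xs, expands_product xs w1 w2.
Proof.
elim: w1 w2 => [|p w1 IH1] w2.
  by exists [:: w2] => N; rewrite big_seq1; exact: mul1r.
elim: w2 => [|q w2 [ys ysE]].
  by exists [:: p :: w1] => N; rewrite big_seq1; exact: mulr1.
have [r _ step] := quasi_shuffle_step p q.
have [xs xsE] := IH1 (q :: w2); have [zs zsE] := IH1 w2.
by eexists; apply: step xsE ysE zsE.
Qed.

Definition admissible_word (w : seq {poly rat}) :=
  if w is p :: _ then p.[0] == 0 else false.

(** Only the outermost step matters: it fixes the leading letter as p, q or their merger, while the
    tails are unrestricted. *)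
Lemma quasi_shuffle_admissible w1 w2 :
  admissible_word w1 -> admissible_word w2 ->
  exists2 xs, expands_product xs w1 w2 & all admissible_word xs.
Proof.
case: w1 w2 => // p w1 [//|q w2] p0 q0.
have [r r0 step] := quasi_shuffle_step p q.
have [xs xsE] := quasi_shuffle w1 (q :: w2).
have [ys ysE] := quasi_shuffle (p :: w1) w2.
have [zs zsE] := quasi_shuffle w1 w2.
eexists; first exact: step xsE ysE zsE.
rewrite !all_cat !all_map.
apply/and3P; split; apply/allP => x _ //=.
by rewrite r0 // (eqP q0).
Qed.

(** * Expansion into monomials and passage to the limit *)

Lemma letter_series_sum p u : letter_series p u =
  \sum_(i < size p) p`_i *: letter_series 'X^i u.
Proof.
apply: fpsP => n; rewrite coefs_sum /= horner_coef.
case: ifP => _; apply/esym; last by rewrite big1 // => i _; rewrite mulr0.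
by apply: eq_bigr => i _; rewrite hornerXn.
Qed.

Lemma word_series_sum w1 p w2 N : word_series (w1 ++ p :: w2) N =
  \sum_(i < size p) p`_i *: word_series (w1 ++ 'X^i :: w2) N.
Proof.
elim: w1 N => [|q w1 IH] N /=; rewrite word_series_cons.
  under [RHS]eq_bigr do rewrite word_series_cons scaler_sumr.
  rewrite exchange_big; apply: eq_bigr => k _ /=.
  rewrite letter_series_sum mulr_suml.
  by apply: eq_bigr => i _; rewrite scalerAl.
under [RHS]eq_bigr do rewrite word_series_cons scaler_sumr.
rewrite exchange_big; apply: eq_bigr => k _ /=.
by rewrite IH mulr_sumr; apply: eq_bigr => i _; rewrite scalerAr.
Qed.

(** A term with leading index u_1 > n has no monomial of degree at most n. *)
Lemma word_series_stable w n N : (n <= N)%N ->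
  coefs (word_series w N) n = coefs (word_series w n) n.
Proof.
case: w => // p w /subnK <-; elim: (N - n)%N => // k IH.
rewrite addSn word_series_consS coefsD {}IH coefsM big1 ?addr0 // => i _.
have ik : (i < (k + n).+1)%N by rewrite (leq_trans (ltn_ord i)) // ltnS leq_addl.
case: i ik => [[|i] _] /= ik; first by rewrite mul0r.
by rewrite gtnNdvd // mul0r.
Qed.

(** The coefficientwise limit for N to infinity, by [word_series_stable]. *)
Definition word_limit w : fps rat := Fps (fun n => coefs (word_series w n) n).

Lemma word_limit_mul xs w1 w2 : expands_product xs w1 w2 ->
  word_limit w1 * word_limit w2 = \sum_(x <- xs) word_limit x.
Proof.
move=> xsE; apply: fpsP => n.
transitivity (coefs (word_series w1 n * word_series w2 n) n).
  rewrite !coefsM; apply: eq_bigr => i _ /=.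
  by rewrite -!(@word_series_stable _ _ n) ?leq_subr // -ltnS.
by rewrite xsE !coefs_sum.
Qed.

Lemma word_limit_sum w1 p w2 : word_limit (w1 ++ p :: w2) =
  \sum_(i < size p) p`_i *: word_limit (w1 ++ 'X^i :: w2).
Proof. by apply: fpsP => n; rewrite /= word_series_sum !coefs_sum. Qed.

(** * Monomial words and brackets *)

Definition monomial_word (r : seq nat) : seq {poly rat} := [seq 'X^k | k <- r].

Definition decreasing l M (u : {ffun 'I_l -> 'I_M.+1}) : bool :=
  [forall i : 'I_l, forall j : 'I_l, (i < j)%N ==> (u j < u i)%N].

Definition ffun_cons (T : Type) l (x : T * {ffun 'I_l -> T}) :
    {ffun 'I_l.+1 -> T} :=
  [ffun i => if unlift ord0 i is Some j then x.2 j else x.1].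

Lemma ffun_cons0 T l (x : T * {ffun 'I_l -> T}) : ffun_cons x ord0 = x.1.
Proof. by rewrite ffunE unlift_none. Qed.

Lemma ffun_consS T l (x : T * {ffun 'I_l -> T}) i :
  ffun_cons x (lift ord0 i) = x.2 i.
Proof. by rewrite ffunE liftK. Qed.

Lemma ffun_cons_bij T l : bijective (@ffun_cons T l).
Proof.
exists (fun f : {ffun 'I_l.+1 -> T} => (f ord0, [ffun i => f (lift ord0 i)]))
  => [[x f]|f].
  rewrite ffun_cons0; congr pair; apply/ffunP => i.
  by rewrite ffunE ffun_consS.
apply/ffunP => i; case: (unliftP ord0 i) => [j|] ->.
  by rewrite ffun_consS ffunE.
by rewrite ffun_cons0.
Qed.

(** Being below u_1 means being at most u_1 - 1, the bound that [word_series] passes to the tail of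
    a word. *)
Lemma decreasing_ffun_cons l M N (x : 'I_M.+1 * {ffun 'I_l -> 'I_M.+1}) :
  decreasing (ffun_cons x) && [forall i, 0 < ffun_cons x i <= N]%N =
  (0 < x.1 <= N)%N && (decreasing x.2 && [forall i, 0 < x.2 i <= x.1.-1]%N).
Proof.
case: x => x u /=.
apply/andP/and3P => [[/forallP d /forallP b]|[xN /forallP d /forallP b]].
  have := b ord0; rewrite ffun_cons0 /= => xN; split=> //.
    apply/forallP => i; apply/forallP => j; apply/implyP => ij.
    by have /forallP/(_ (lift ord0 j)) := d (lift ord0 i); rewrite !ffun_consS !lift0 ltnS ij.
  apply/forallP => i; have := b (lift ord0 i); rewrite ffun_consS => /andP[-> _] /=.
  have /forallP/(_ (lift ord0 i)) := d ord0; rewrite ffun_cons0 ffun_consS lift0 /=.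
  by case/andP: xN; case: (x : nat).
have x0 : (x.-1 < x)%N by case/andP: xN => x0 _; rewrite prednK.
split; apply/forallP => i.
  apply/forallP => j; apply/implyP.
  case: (unliftP ord0 i) => [i'|] ->; case: (unliftP ord0 j) => [j'|] ->;
    rewrite ?ffun_cons0 ?ffun_consS ?lift0 //=.
    by rewrite ltnS => ij; have /forallP/(_ j')/implyP/(_ ij) := d i'.
  by move=> _; have /andP[_ h] := b j'; apply: leq_ltn_trans h x0.
case: (unliftP ord0 i) => [j|] ->; rewrite ?ffun_cons0 ?ffun_consS //=.
have /andP[-> h] /= := b j; case/andP: xN => _; apply: leq_trans.
by rewrite (leq_trans h) // leq_pred.
Qed.

(** M fixes the type of the index functions while the recursion lowers N. *)
Lemma word_series_monomial M r N : (N <= M)%N ->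
  word_series (monomial_word r) N =
  \sum_(u : {ffun 'I_(size r) -> 'I_M.+1} |
        decreasing u && [forall i, 0 < u i <= N]%N)
    \prod_(i < size r) letter_series 'X^(nth 0%N r i) (u i).
Proof.
elim: r N => [|a r IH] N NM.
  rewrite (bigD1 [ffun=> ord0]) /=; last first.
    by apply/andP; split; apply/forallP => -[].
  rewrite big_ord0 big1 ?addr0 // => u /andP[_ /eqP[]].
  by apply/ffunP => -[].
rewrite word_series_cons.
rewrite (big_ord_widen _ (fun k => letter_series 'X^a k.+1 *
  word_series (monomial_word r) k) NM).
(* Passes from k to the index u_1 = k + 1 itself; x = 0 is filtered out. *)
transitivity (\sum_(x < M.+1 | (0 < x <= N)%N) letter_series 'X^a x *
    word_series (monomial_word r) x.-1).
  by rewrite [RHS]big_mkcond big_ord_recl /= add0r -big_mkcond.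
under eq_bigr => x xN.
  rewrite IH; last by rewrite -ltnS (leq_ltn_trans (leq_pred _)).
  rewrite mulr_sumr; over.
rewrite pair_big_dep /= (reindex _ (onW_bij _ (@ffun_cons_bij 'I_M.+1 (size r)))) /=.
apply: eq_big => x; first by rewrite decreasing_ffun_cons.
move=> _; rewrite big_ord_recl ffun_cons0; congr (_ * _).
by apply: eq_bigr => i _; rewrite ffun_consS.
Qed.

(** As u > 0, u v <= n forces v <= n; the finite sum can then be distributed over products. *)
Lemma letter_series_upto n p u : (0 < u)%N ->
  eq_upto n (letter_series p u)
    (\sum_(v < n.+1 | (0 < v)%N) p.[v%:R] *: fps_monom rat (u * v)).
Proof.
move=> u0 m mn; rewrite coefs_sum /=.
case: ifP => [/andP[m0 um]|mu]; last first.
  rewrite big1 // => v v0; case: eqP => [e|]; last by rewrite mulr0.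
  by rewrite e muln_gt0 u0 v0 dvdn_mulr in mu.
have vn : (m %/ u < n.+1)%N by rewrite ltnS (leq_trans (leq_div _ _)).
rewrite (bigD1 (Ordinal vn)) /=; last by rewrite divn_gt0 // dvdn_leq.
rewrite mulnC divnK // eqxx mulr1 big1 ?addr0 // => v /andP[_ ne].
case: eqP => [e|]; last by rewrite mulr0.
by case/eqP: ne; apply: val_inj; rewrite /= e mulKn.
Qed.

Lemma coefs_prod_letter_series n l (r : 'I_l -> nat) (u : 'I_l -> nat) :
  (forall i, 0 < u i)%N ->
  coefs (\prod_i letter_series 'X^(r i) (u i)) n =
  \sum_(v : {ffun 'I_l -> 'I_n.+1} |
       [forall i, 0 < v i]%N && (\sum_i u i * v i == n)%N)
     (\prod_i v i ^ r i)%N%:R.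
Proof.
move=> u0.
have E := @eq_upto_prod _ n _ (index_enum 'I_l) _ _
  (fun i => @letter_series_upto n 'X^(r i) (u i) (u0 i)).
rewrite E // bigA_distr_big coefs_sum big_mkcond [RHS]big_mkcond.
apply: eq_bigr => v _.
have -> : (v \in ffun_on (fun j : 'I_n.+1 => (0 < j)%N)) = [forall i, 0 < v i]%N.
  by apply/ffun_onP/forallP.
case: ifP => //= _.
rewrite scaler_prod coefsZ.
have -> : \prod_i fps_monom rat (u i * v i) = fps_monom rat (\sum_i u i * v i).
  by rewrite (big_morph _ (@fps_monomD rat) (erefl _)).
rewrite /= eq_sym; case: eqP => _; last by rewrite mulr0.
by rewrite mulr1 natr_prod; apply: eq_bigr => i _; rewrite hornerXn natrX.
Qed.

Lemma coefs_word_limit_monomial r n :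
  coefs (word_limit (monomial_word r)) n = (sigma r n)%:R.
Proof.
rewrite /= (@word_series_monomial n) // coefs_sum.
under eq_bigr => u /andP[_ /forallP u0].
  rewrite coefs_prod_letter_series; last by move=> i; case/andP: (u0 i).
  over.
rewrite pair_big_dep /= natr_sum.
apply: eq_bigl => -[u v] /=; rewrite -/(decreasing u).
have -> : [forall i, 0 < u i <= n]%N = [forall i, 0 < u i]%N.
  by apply: eq_forallb => i; rewrite leq_ord andbT.
by rewrite [RHS]andbA [RHS]andbACA [X in _ = X && _]andbC.
Qed.

Lemma prod_fact_neq0 (r : seq nat) : (\prod_(k <- r) k`!)%:R != 0 :> rat.
Proof.
rewrite Num.Theory.pnatr_eq0 -lt0n; elim/big_ind: _ => // [x y|k _].
  by rewrite muln_gt0 => -> ->.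
exact: fact_gt0.
Qed.

Lemma bracket_word_limit r : (0 < size r)%N ->
  word_limit (monomial_word r) =
  (\prod_(k <- r) k`!)%:R *: bracket [seq k.+1 | k <- r].
Proof.
move=> r0; apply: fpsP => n; rewrite coefs_word_limit_monomial /bracket scalerA big_map.
rewrite divff ?prod_fact_neq0 //.
rewrite scale1r /= -map_comp map_id; case: n => //.
(* Only n = 0 is left: the bracket has coefficient 0 there by definition, and the series of a
   nonempty word is an empty sum. *)
rewrite -coefs_word_limit_monomial.
by case: r r0 => // a r _; rewrite /= word_series_cons0.
Qed.

(** * Linear spans and closure under products *)

Section LinSpan.
Variables (R : nzRingType) (V : lmodType R) (A : set V).

Lemma lin_span_gen v : A v -> lin_span A v.
Proof.
by move=> Av; exists 1%N, (fun=> 1), (fun=> v); rewrite big_ord1 scale1r.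
Qed.

Lemma lin_span0 : lin_span A 0.
Proof.
by exists 0%N, (fun=> 0), (fun=> 0); rewrite big_ord0; split => // -[].
Qed.

Lemma lin_spanD u v : lin_span A u -> lin_span A v -> lin_span A (u + v).
Proof.
move=> [m [c [w [wA ->]]]] [m' [c' [w' [wA' ->]]]].
exists (m + m')%N, (fun i => match split i with inl j => c j | inr j => c' j end),
  (fun i => match split i with inl j => w j | inr j => w' j end); split.
  by move=> i; case: (split i).
rewrite big_split_ord; congr (_ + _); apply: eq_bigr => i _.
  by rewrite -[lshift _ i]/(unsplit (inl i)) unsplitK.
by rewrite -[rshift _ i]/(unsplit (inr i)) unsplitK.
Qed.

Lemma lin_spanZ a v : lin_span A v -> lin_span A (a *: v).
Proof.
move=> [m [c [w [wA ->]]]]; exists m, (fun i => a * c i), w; split=> //.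
by rewrite scaler_sumr; apply: eq_bigr => i _; rewrite scalerA.
Qed.

Lemma lin_span_sum I (r : seq I) (P : pred I) (E : I -> V) :
  (forall i, P i -> lin_span A (E i)) -> lin_span A (\sum_(i <- r | P i) E i).
Proof.
move=> EA; elim/big_ind: _ => //; [exact: lin_span0|exact: lin_spanD].
Qed.

End LinSpan.

Lemma lin_spanS (R : nzRingType) (V : lmodType R) (A B : set V) :
  (A `<=` B -> lin_span A `<=` lin_span B)%classic.
Proof.
by move=> AB _ [m [c [w [wA ->]]]]; exists m, c, w; split => // i; apply: AB.
Qed.

(** Letters are expanded from left to right, [a] collecting the exponents already chosen; a
    prescribed prefix can thus keep the first exponent positive. *)
Lemma word_limit_in_span (A : set (fps rat)) a w :
  (forall r, lin_span A (word_limit (monomial_word (a ++ r)))) ->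
  lin_span A (word_limit (monomial_word a ++ w)).
Proof.
elim: w a => [|p w IH] a aA.
  by have := aA [::]; rewrite !cats0.
rewrite word_limit_sum; apply: lin_span_sum => i _; apply: lin_spanZ.
rewrite -cat_rcons -[rcons _ _]map_rcons; apply: IH => r.
by rewrite cat_rcons.
Qed.

(** p(0) = 0 kills the constant monomial of the first letter, so only exponents i > 0 remain, that
    is s_1 = i + 1 > 1. *)
Lemma admissible_word_limit w : admissible_word w -> MDadm (word_limit w).
Proof.
case: w => // p w /eqP p0; rewrite -[p :: w]cat0s word_limit_sum.
apply: lin_span_sum => i _.
have [i0|i0] := posnP i.
  by rewrite i0 -horner_coef0 p0 scale0r; apply: lin_span0.
apply: lin_spanZ; apply: (@word_limit_in_span _ [:: nat_of_ord i]) => r.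
rewrite bracket_word_limit //; apply: lin_spanZ; apply: lin_span_gen; right.
exists [seq k.+1 | k <- nat_of_ord i :: r] => //.
by rewrite /admissible /bracket_index /= ltnS i0 andbT all_map; apply/allP.
Qed.

Lemma bracket_mul s t : admissible s -> admissible t ->
  MDadm (bracket s * bracket t).
Proof.
have bracketE s1 : admissible s1 -> exists2 w, admissible_word w &
    exists a, bracket s1 = a *: word_limit w.
  case: s1 => // k s1 /andP[/andP[_ s1p] k1].
  have rE : [seq j.+1 | j <- [seq j.-1 | j <- k :: s1]] = k :: s1.
    rewrite -map_comp -[RHS]map_id; apply/eq_in_map => j js /=.
    by rewrite prednK //; apply: (allP s1p).
  exists (monomial_word [seq j.-1 | j <- k :: s1]).
    (* k > 1 makes the leading exponent k - 1 positive, so its monomial vanishes at 0. *)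
    by rewrite /= hornerXn expr0n; case: k k1 {s1p rE} => [|[]].
  exists ((\prod_(j <- [seq j.-1 | j <- k :: s1]) j`!)%:R^-1).
  rewrite bracket_word_limit // rE scalerA mulVf ?scale1r //.
  exact: prod_fact_neq0.
move=> /bracketE[w1 w1a [a ->]] /bracketE[w2 w2a [b ->]].
rewrite -scalerAl -scalerAr.
have [xs xsE /allP xsa] := quasi_shuffle_admissible w1a w2a.
rewrite (word_limit_mul xsE); do 2 apply: lin_spanZ.
rewrite big_seq; apply: lin_span_sum => x /xsa; exact: admissible_word_limit.
Qed.

Theorem mainTheorem4 :
  (MDadm `<=` MD)%classic /\ GRing.subalg_closed (mem MDadm).
Proof.
split.
  apply: lin_spanS => f [->|[s /andP[sb _] ->]]; first by left.
  by right; exists s.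
split.
- by apply/mem_set/lin_span_gen; left.
- move=> a u v /set_mem uA /set_mem vA; apply/mem_set.
  exact: lin_spanD (lin_spanZ a uA) vA.
(* By bilinearity it suffices to multiply generators, and a factor 1 is immediate. *)
move=> u v /set_mem[m [c [w [wA ->]]]] /set_mem[m' [c' [w' [wA' ->]]]].
apply/mem_set; rewrite mulr_suml; apply: lin_span_sum => i _.
rewrite mulr_sumr; apply: lin_span_sum => j _.
rewrite -scalerAl -scalerAr; do 2 apply: lin_spanZ.
case: (wA i) (wA' j) => [->|[s sa ->]] [->|[t ta ->]].
- by rewrite mulr1; apply: lin_span_gen; left.
- by rewrite mul1r; apply: lin_span_gen; right; exists t.
- by rewrite mulr1; apply: lin_span_gen; right; exists s.
exact: bracket_mul.
Qed.
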